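(* Whether a given instance of Solitaire Hanabi in which all cards have the same color ($c=1$) admits a winning play sequence can be decided in $O(N+n\log h)$ time, where $N$ is the number of cards in the deck, $n$ the number of values and $h$ the hand size (no restriction on the multiplicity).
   Context: Solitaire Hanabi: a card is a pair $(a,k)$ with value $a\in\{1,\dots,n\}$ and color $k\in\{1,\dots,c\}$. An instance consists of the hand size $h$ and a fully known deck $\sigma$ of $N$ cards drawn one by one in order, starting with an empty hand. When a card is drawn the player may discard it (gone forever), store it in hand, or play it immediately; at no time may more than $h$ cards be stored in hand. A card $(a,k)$ may be played iff either $a=1$ and no card of color $k$ has been played, or the last card of color $k$ played has value $a-1$. After playing a card, the player may also play stored cards obeying the same rule. A winning play sequence is one that plays (one copy of) every card $(a,k)$, $1\le a\le n$, $1\le k\le c$. *)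

(* Defs.v *)
From mathcomp Require Import all_boot.
Set Implicit Arguments. Unset Strict Implicit. Unset Printing Implicit Defensive.

(* A hcard (a, k): value a, color k. *)
Definition hcard := (nat * nat)%type.

(* Game state: [pl k] = value of the last hcard of color k played (0 if none),
   [hand] = stored cards. *)
Record hstate := HState { pl : nat -> nat; hand : seq hcard }.

Definition init_state : hstate := HState (fun _ => 0) [::].

(* (a,k) may be played iff (a = 1 and no hcard of color k played) or
   the last hcard of color k played has value a-1. *)
Definition playable (f : nat -> nat) (x : hcard) : bool :=
  (0 < x.1) && (f x.2 == x.1.-1).

Definition upd (f : nat -> nat) (k v : nat) : nat -> nat :=
  fun j => if j == k then v else f j.

Definition play_card (f : nat -> nat) (x : hcard) : nat -> nat := upd f x.2 x.1.

Inductive play_stored : hstate -> hstate -> Prop :=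
| ps_stop s : play_stored s s
| ps_play f H y s' :
    y \in H -> playable f y ->
    play_stored (HState (play_card f y) (rem y H)) s' ->
    play_stored (HState f H) s'.

Inductive draw_step (h : nat) (x : hcard) : hstate -> hstate -> Prop :=
| ds_discard s : draw_step h x s s
| ds_store f H : size H < h -> draw_step h x (HState f H) (HState f (x :: H))
| ds_play f H s' :
    playable f x -> play_stored (HState (play_card f x) H) s' ->
    draw_step h x (HState f H) s'.

Inductive hrun (h : nat) : seq hcard -> hstate -> hstate -> Prop :=
| hr_nil s : hrun h [::] s s
| hr_cons x d s1 s2 s3 :
    draw_step h x s1 s2 -> hrun h d s2 s3 -> hrun h (x :: d) s1 s3.

(* A winning play sequence exists: every hcard (a,k), 1<=a<=n, 1<=k<=c,
   gets played, i.e. at the end the last played value of every color is n. *)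
Definition winnable (n c h : nat) (deck : seq hcard) : Prop :=
  exists s, hrun h deck init_state s /\ forall k, 1 <= k <= c -> pl s k = n.

(* Unit-cost RAM with registers and memory holding words (naturals < W). *)
Inductive instr :=
| IConst (r k : nat)
| IAdd (r a b : nat)
| ISub (r a b : nat)
| IMul (r a b : nat)
| ILoad (r a : nat)
| IStore (a r : nat)
| IJz (r l : nat)
| IHalt.

Record config := Config { pc : nat; regs : nat -> nat; mem : nat -> nat }.

(* One step; [None] means the machine has halted (IHalt or pc out of range). *)
Definition exec1 (W : nat) (P : seq instr) (c : config) : option config :=
  let R := regs c in let M := mem c in
  match nth IHalt P (pc c) with
  | IHalt => None
  | IConst r k => Some (Config (pc c).+1 (upd R r (k %% W)) M)
  | IAdd r a b => Some (Config (pc c).+1 (upd R r ((R a + R b) %% W)) M)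
  | ISub r a b => Some (Config (pc c).+1 (upd R r (R a - R b)) M)
  | IMul r a b => Some (Config (pc c).+1 (upd R r ((R a * R b) %% W)) M)
  | ILoad r a => Some (Config (pc c).+1 (upd R r (M (R a))) M)
  | IStore a r => Some (Config (pc c).+1 R (upd M (R a) (R r)))
  | IJz r l => Some (Config (if R r == 0 then l else (pc c).+1) R M)
  end.

(* [run_ram W P t.+1 c = Some out] iff P halts from c after at most t steps,
   with output register 0 equal to out. *)
Fixpoint run_ram (W : nat) (P : seq instr) (fuel : nat) (c : config)
  : option nat :=
  match fuel with
  | 0 => None
  | fuel'.+1 =>
      match exec1 W P c with
      | None => Some (regs c 0)
      | Some c' => run_ram W P fuel' c'
      end
  end.

(* Word size: words range over [0, W), W polynomial in the input parameters
   (so a word has Theta(log(N + n + h)) bits, transdichotomous assumption). *)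
Definition word_bound (n h N : nat) : nat := (N + n + h + 4) ^ 2.

Definition init_config (n h : nat) (vals : seq nat) : config :=
  Config 0 (fun _ => 0)
    (fun i => if i == 0 then n else if i == 1 then h
              else if i == 2 then size vals else nth 0 vals (i - 3)).

(* Main.v *)
Require Import Defs.
From mathcomp Require Import all_boot.
From mathcomp Require Import zify.
Set Implicit Arguments. Unset Strict Implicit. Unset Printing Implicit Defensive.

(** Read the deck backwards.  Between two draws, keep the last value [m] played
    so far and the set [D] of values above [m] that must be in hand at that
    moment.  Going back over a draw of [x > m] removes [x] from [D], since it can
    be stored exactly then.  Going back over a draw of [x <= m], one may decide
    that [x] is played at this draw, followed by [x+1, ..., m] from hand: this
    lowers [m] to [x-1] and adds [x+1, ..., m] to [D].  Doing so whenever the hand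
    size allows it is optimal, because [(m, D)] is at least as good as [(m', D')]
    as soon as [m <= m'] and [D] is included in the union of [D'] and
    [m+1, ..., m'].  The instance is winnable iff this greedy process ends with
    [m = 0] and [D] empty.  With one flag per value each draw takes constant time,
    so even [O(N)] steps suffice. *)

Definition back_step (h x : nat) (st : nat * seq nat) : nat * seq nat :=
  let: (m, D) := st in
  if x <= m then
    if size D + (m - x) <= h then (x.-1, iota x.+1 (m - x) ++ D) else (m, D)
  else (m, rem x D).

Arguments back_step : simpl never.

Definition back_greedy (n h : nat) (vals : seq nat) : nat * seq nat :=
  foldr (back_step h) (n, [::]) vals.

Definition back_inv (n h : nat) (st : nat * seq nat) : Prop :=
  [/\ st.1 <= n, size st.2 <= h, uniq st.2 & all (fun v => st.1 < v) st.2].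

Lemma back_step_inv n h x st :
  0 < x -> back_inv n h st -> back_inv n h (back_step h x st).
Proof.
case: st => m D x0 [/= mn Dh uD aD]; rewrite /back_step.
case: (leqP x m) => [xm|mx]; last first.
  split=> //=; first exact: leq_trans (size_subseq (rem_subseq _ _)) Dh.
  - exact: rem_uniq.
  - by apply/allP => v /mem_rem; apply: (allP aD).
case: (leqP (size D + (m - x)) h) => // cap; split=> /=; first by lia.
- by rewrite size_cat size_iota addnC.
- rewrite cat_uniq iota_uniq uD andbT /=; apply/hasPn => v /(allP aD).
  by rewrite mem_iota; lia.
- rewrite all_cat; apply/andP; split; apply/allP => v.
    by rewrite mem_iota; lia.
  by move/(allP aD); lia.
Qed.

Lemma back_greedy_inv n h vals :
  all (fun x => 0 < x) vals -> back_inv n h (back_greedy n h vals).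
Proof.
elim: vals => [|x vals IH] /=; first by split.
by case/andP=> x0 /IH; apply: back_step_inv.
Qed.

Lemma back_stepNmem n h x m D :
  back_inv n h (m, D) -> x \notin (back_step h x (m, D)).2 \/
  x <= m /\ back_step h x (m, D) = (m, D).
Proof.
case=> /= mn Dh uD aD; rewrite /back_step.
case: (leqP x m) => [xm|mx]; last by left; rewrite mem_rem_uniq // inE eqxx.
case: (leqP (size D + (m - x)) h) => cap; last by right.
left; rewrite /= mem_cat mem_iota ltnn /=.
by apply/negP => /(allP aD); lia.
Qed.

(** * Optimality of the greedy process against an arbitrary run *)

Definition monochrome (s : seq hcard) : bool := all (fun x => x.2 == 1) s.

Definition dominates (st : nat * seq nat) (f : nat -> nat) (H : seq hcard) : Prop :=
  st.1 <= f 1 /\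
  forall v, v \in st.2 -> (v, 1) \in H \/ st.1 < v <= f 1.

(** A stored card is playable only when its value is one above the last, so every value gained comes
    from the hand. *)
Lemma play_stored_spec s s' :
  play_stored s s' -> monochrome (hand s) ->
  [/\ pl s 1 <= pl s' 1, {subset hand s' <= hand s},
      size (hand s') <= size (hand s) &
      forall v, pl s 1 < v <= pl s' 1 -> (v, 1) \in hand s].
Proof.
elim=> {s s'} [s _|f H [y c] s' yH py _ IH /= mH].
  by split=> // v; lia.
have /= /eqP c1 := allP mH _ yH; subst c.
have [|le sub sz ch] := IH.
  by apply/allP => z /= /mem_rem; apply: (allP mH).
move: py le ch; rewrite /playable /play_card /upd /= => /andP[y0 /eqP fy] le ch.
split; first by lia.
- by move=> z /sub /= /mem_rem.
- exact: leq_trans sz (size_subseq (rem_subseq _ _)).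
- move=> v vb; have [->//|vy] := eqVneq v y.
  by apply: (@mem_rem _ (y, 1)); apply: ch; lia.
Qed.

(** This is the case of a discard: the values [x+1, ..., m] added to [D] are at most [f 1], so the
    run is already past them. *)
Lemma dominates_back_step n h x m D f H :
  0 < x -> back_inv n h (m, D) -> dominates (m, D) f H ->
  dominates (back_step h x (m, D)) f H.
Proof.
move=> x0 [/= _ _ uD aD] [/= mf DH]; rewrite /back_step.
case: (leqP x m) => [xm|mx]; last by split=> //= v /mem_rem /DH.
case: (leqP (size D + (m - x)) h) => // cap; split=> /=; first by lia.
move=> v; rewrite mem_cat mem_iota => /orP[vb|/DH [->|?]]; [right|left|right] => //; lia.
Qed.

Lemma hrun_dominated n h d s s' :
  hrun h d s s' -> pl s' 1 = n -> all (fun x => 0 < x.1) d -> monochrome d ->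
  monochrome (hand s) -> size (hand s) <= h ->
  dominates (back_greedy n h (map fst d)) (pl s) (hand s).
Proof.
elim=> {d s s'} [s <- _ _ _ _|[x c] d s1 s2 s3 dr _ IH pn /andP[/= x0 d0]].
  by split.
case/andP=> /= /eqP c1 md mH sH; subst c.
have := @back_greedy_inv n h (map fst d).
rewrite all_map => /(_ d0).
move: (back_greedy n h (map fst d)) IH => [m D] /(_ pn d0 md) IH inv.
move E: (x, 1) dr => y dr; case: dr E IH mH sH => {s1 s2}.
- move=> s _ IH mH sH; apply: dominates_back_step inv _ => //; exact: IH.
- move=> f H sz <- /= IH mH _.
  have := dominates_back_step x0 inv (IH mH sz).
  case=> le sub; split=> // v vD.
  case: (sub v vD) => [|?]; last by right.
  rewrite inE => /predU1P[[vx]|]; last by left.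
  subst v; case: (back_stepNmem x inv) => [|[xm e]]; first by rewrite vD.
  by move: vD; rewrite e /=; case: inv => /= _ _ _ /allP aD /aD; lia.
move=> f H s' py ps E; move: py ps; rewrite -E => {E y}.
move=> /andP[_ /=/eqP fx] /play_stored_spec /= spec IH mH sH.
have {spec} := spec mH; rewrite /play_card /upd /= => -[le sub sz ch].
have [|/= le' DH] := IH _ (leq_trans sz sH).
  by apply/allP => z /sub; apply: (allP mH).
case: (inv) => /= _ _ uD aD.
(* After the draw, [v] is either still in hand or was played from hand right after [x]. *)
have inH v : v \in D -> m < v -> x < v -> (v, 1) \in H.
  by move=> vD mv xv; case: (DH v vD) => [/sub//|vb]; apply: ch; lia.
rewrite /dominates /back_step; case: (leqP x m) => [xm|mx]; last first.
  split=> /=; first by lia.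
  move=> v; rewrite mem_rem_uniq // inE => /andP[/= vx vD].
  have mv := allP aD _ vD.
  by case: (ltnP x v) => xv; [left; apply: inH|right; lia].
have subH v : v \in iota x.+1 (m - x) ++ D -> (v, 1) \in H.
  rewrite mem_cat mem_iota => /orP[vb|vD]; first by apply: ch; lia.
  by have mv := allP aD _ vD; apply: inH => //; lia.
(* All required values are distinct and sit in the actual hand, so the capacity test of the greedy
   succeeds. *)
have -> : size D + (m - x) <= h.
  apply: leq_trans sH; rewrite addnC -{1}(size_iota x.+1 (m - x)) -size_cat.
  rewrite -(size_map (fun v => (v, 1))); apply: uniq_leq_size.
    rewrite map_inj_uniq; last by move=> u v [].
    rewrite cat_uniq iota_uniq uD andbT /=; apply/hasPn => v /(allP aD).
    by rewrite mem_iota; lia.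
  by move=> z /mapP[v vD ->]; apply: subH.
by split=> /=; [lia|move=> v vD; left; apply: subH].
Qed.

(** * Conversion of the greedy process into a run *)

Lemma play_stored_chain k x f H T :
  f 1 = x -> perm_eq H (map (fun v => (v, 1)) (iota x.+1 k) ++ T) ->
  exists f' H', [/\ play_stored (HState f H) (HState f' H'),
                    f' 1 = x + k & perm_eq H' T].
Proof.
elim: k x f H => [|k IH] x f H fx pH.
  by exists f, H; split; [apply: ps_stop | rewrite addn0 |].
have yH : (x.+1, 1) \in H by rewrite (perm_mem pH) inE eqxx.
have [||f' [H' [ps fk pH']]] := IH x.+1 (play_card f (x.+1, 1)) (rem (x.+1, 1) H).
- by rewrite /play_card /upd /=.
- by rewrite -(perm_cons (x.+1, 1)); apply: perm_trans pH; rewrite perm_sym perm_to_rem.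
exists f', H'; split=> //; last by rewrite fk addSnnS.
by apply: ps_play ps => //; rewrite /playable /= fx.
Qed.

(** The run keeps exactly [D] in hand: a drawn [x] above [m] is stored if [D] requires it later and
    discarded otherwise. *)
Lemma hrun_back_greedy n h d f H :
  all (fun x => 0 < x.1) d -> monochrome d ->
  let: (m, D) := back_greedy n h (map fst d) in
  f 1 = m -> perm_eq H (map (fun v => (v, 1)) D) ->
  exists s, hrun h d (HState f H) s /\ pl s 1 = n.
Proof.
elim: d f H => [|[x c] d IH] f H /=.
  by move=> _ _ fn _; exists (HState f H); split=> //; apply: hr_nil.
case/andP=> x0 d0 /andP[/= /eqP c1 md]; subst c.
have := @back_greedy_inv n h (map fst d).
rewrite all_map => /(_ d0).
move: (back_greedy n h (map fst d)) IH => [m D] IH [/= _ Dh _ _].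
have skip : f 1 = m -> perm_eq H [seq (v, 1) | v <- D] ->
    exists s, hrun h ((x, 1) :: d) (HState f H) s /\ pl s 1 = n.
  move=> fm pH; have [s [rs sn]] := IH f H d0 md fm pH.
  by exists s; split=> //; apply: hr_cons rs; apply: ds_discard.
rewrite /back_step; case: (leqP x m) => [xm|mx].
  case: (leqP (size D + (m - x)) h) => // cap fx; rewrite map_cat => pH.
  have [|f' [H' [ps fk pH']]] :=
    @play_stored_chain _ x (play_card f (x, 1)) H _ _ pH.
    by rewrite /play_card /upd.
  have [|s [rs sn]] := IH f' H' d0 md _ pH'; first by lia.
  exists s; split=> //; apply: hr_cons rs; apply: ds_play ps.
  by rewrite /playable /= x0 fx /=.
have [xD|xD] := boolP (x \in D); last by rewrite rem_id.
move=> fm pH.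
have pH' : perm_eq ((x, 1) :: H) [seq (v, 1) | v <- D].
  by rewrite perm_sym (perm_trans (perm_map _ (perm_to_rem xD))) //= perm_cons perm_sym.
have [s [rs sn]] := IH f _ d0 md fm pH'.
exists s; split=> //; apply: hr_cons rs; apply: ds_store.
by apply: leq_trans Dh; rewrite -(size_map (fun v => (v, 1)) D) -(perm_size pH').
Qed.

Lemma winnableP n h deck :
  all (fun x : hcard => (1 <= x.1 <= n) && (x.2 == 1)) deck ->
  winnable n 1 h deck <-> back_greedy n h (map fst deck) = (0, [::]).
Proof.
move=> ok.
have d0 : all (fun x : hcard => 0 < x.1) deck.
  by apply: sub_all ok => x /andP[/andP[]].
have md : monochrome deck by apply: sub_all ok => x /andP[].
split=> [[s [rs sn]]|e].
  have [] := hrun_dominated rs (sn 1 isT) d0 md isT isT.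
  have := @back_greedy_inv n h (map fst deck); rewrite all_map => /(_ d0).
  case: (back_greedy _ _ _) => m [|v D] [/= _ _ _ aD]; first by case: m aD.
  by move=> m0 /(_ v); rewrite inE eqxx => /(_ isT) [//|]; lia.
have := @hrun_back_greedy n h deck (fun _ => 0) [::] d0 md; rewrite e.
case=> // s [rs sn]; exists s; split=> // k k1.
by have -> : k = 1 by lia.
Qed.

(** * Implementation on the RAM in linear time *)

(* Registers: 1 = [m], 2 = [size D], 3 = [h], 4 = 1, 5 = number of cards still
   to be read, 6 = [N + 2], 7 = 2, 8 = the card [x], 9 = address of its flag;
   0 holds zero until the last instruction.  The flag of value [v], at address
   [N + 2 + v], is set iff [v] is above [m] and not in [D]. *)
Definition back_prog : seq instr :=
  [:: ILoad 1 0; IConst 4 1; ILoad 3 4; IConst 7 2; ILoad 5 7; IAdd 6 5 7;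
   (* 6 *) IJz 5 27; IAdd 8 5 7; ILoad 8 8; ISub 5 5 4; IAdd 9 6 8;
           ISub 10 8 1; IJz 10 18;
   (* 13: [m < x] *) ILoad 10 9; ISub 10 4 10; ISub 2 2 10; IStore 9 4; IJz 0 6;
   (* 18: [x <= m] *) ISub 10 1 8; IAdd 10 2 10; ISub 11 10 3; IJz 11 23; IJz 0 6;
   (* 23 *) IAdd 2 10 0; ISub 1 8 4; IStore 9 4; IJz 0 6;
   (* 27 *) IAdd 2 2 1; ISub 0 4 2; IHalt].

Definition loop_inv (n h : nat) (vals : seq nat) (i : nat) (c : config) : Prop :=
  let: (m, D) := back_greedy n h (drop i vals) in
  [/\ pc c = 6,
      [/\ regs c 0 = 0, regs c 1 = m, regs c 2 = size D & regs c 3 = h],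
      [/\ regs c 4 = 1, regs c 5 = i, regs c 6 = (size vals).+2 & regs c 7 = 2],
      (forall j, j < size vals -> Defs.mem c j.+3 = nth 0 vals j) &
      (forall v, 0 < v <= n -> Defs.mem c ((size vals).+2 + v) = (m < v) && (v \notin D))].


Lemma run_ramS W P fuel c c' :
  exec1 W P c = Some c' -> run_ram W P fuel.+1 c = run_ram W P fuel c'.
Proof. by move=> /= ->. Qed.

Ltac ram_step eqs :=
  rewrite addnS; erewrite run_ramS; last by rewrite /exec1 /= /upd /= ?eqs /=.

(** The longest path reads and compares (7 instructions), tests capacity (4) and plays (4). The
    bound on [W] keeps addresses and sums from wrapping. *)
Lemma run_ram_iteration n h vals W i c :
  size vals + n + h + 4 <= W -> all (fun x => 0 < x <= n) vals ->
  i < size vals -> loop_inv n h vals i.+1 c ->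
  exists k c', [/\ k <= 15, loop_inv n h vals i c' &
    forall fuel, run_ram W back_prog (k + fuel) c = run_ram W back_prog fuel c'].
Proof.
case: c => p R M hW ok iN; rewrite /loop_inv (drop_nth 0 iN) /=.
have ok0 : all (fun x => 0 < x) (drop i.+1 vals).
  apply/allP => x /mem_drop xv; by have /andP[] := allP ok _ xv.
have := back_greedy_inv n h ok0.
case: (back_greedy n h _) => m D [/= mn Dh uD aD].
case=> -> [R0 R1 R2 R3] [R4 R5 R6 R7] Mv Mf.
have := allP ok _ (mem_nth 0 iN); move E : (nth 0 vals i) => x /andP[x0 xn].
have Mx : M ((i.+1 + 2) %% W) = x.
  by rewrite modn_small ?addn2 ?Mv //; lia.
have Ma : ((size vals).+2 + x) %% W = (size vals).+2 + x.
  by rewrite modn_small //; lia.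

rewrite /back_step.
pose eqs := (R0, R1, R2, R3, (R4, R5, R6, R7), Mx, Ma).
have [xm|mx] := leqP x m.
  (* Subtraction truncates at zero, so [ISub] followed by [IJz] decides a comparison. *)
  have r1 : x - m = 0 by lia.
  have r2 : (size D + (m - x)) %% W = size D + (m - x).
    by rewrite modn_small //; lia.
  have [cap|cap] := leqP (size D + (m - x)) h.
    have r3 : size D + (m - x) - h = 0 by lia.
    have r4 : (size D + (m - x) + 0) %% W = size D + (m - x).
      by rewrite addn0.
    pose eqs' := (eqs, r1, r2, r3, r4).
    eexists 15, _; split=> //; last first.
      by move=> fuel; rewrite addnC; do 15 (ram_step eqs'); rewrite addn0.
    split=> //=.
    - by split; rewrite // ?size_cat ?size_iota 1?addnC //; lia.
    - by split=> //; lia.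
    - by move=> j jN; rewrite /upd ifF ?Mv //; lia.
    (* The values [x+1, ..., m] rise above the new [m] and enter [D] at once, so their flags stay
       unset; only that of [x] changes. *)
    move=> v vn; rewrite /upd mem_cat mem_iota Mf // eqn_add2l.
    case: eqVneq => [->|vx].
      rewrite ltnn prednK // leqnn /=.
      by case: (boolP (x \in D)) => // /(allP aD); lia.
    by rewrite negb_or andbA; congr andb; lia.
  have r3 : size D + (m - x) - h == 0 = false by lia.
  pose eqs' := (eqs, r1, r2, r3).
  eexists 12, _; split=> //; last first.
    by move=> fuel; rewrite addnC; do 12 (ram_step eqs'); rewrite addn0.
  split=> //=; by split=> //; lia.
have r1 : x - m == 0 = false by lia.
(* One minus this flag is the amount by which [size D] drops. *)
have Mfx : M ((size vals).+2 + x) = (x \notin D) by rewrite Mf ?mx ?x0.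
pose eqs' := (eqs, r1, Mfx).
eexists 12, _; split=> //; last first.
  by move=> fuel; rewrite addnC; do 12 (ram_step eqs'); rewrite addn0.
split=> //=.
- split=> //; have [xD|xD] := boolP (x \in D); last by rewrite rem_id // subn0.
  by rewrite size_rem // subn1.
- by split=> //; lia.
- by move=> j jN; rewrite /upd ifF ?Mv //; lia.
move=> v vn; rewrite /upd mem_rem_uniq // inE Mf // eqn_add2l.
by case: eqVneq => //= ->; rewrite mx.
Qed.

Lemma run_ram_loop n h vals W i fuel c :
  size vals + n + h + 4 <= W -> all (fun x => 0 < x <= n) vals ->
  i <= size vals -> 15 * i + 4 <= fuel -> loop_inv n h vals i c ->
  run_ram W back_prog fuel c =
    Some (1 - (size (back_greedy n h vals).2 + (back_greedy n h vals).1)).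
Proof.
move=> hW ok; elim: i fuel c => [|i IH] fuel c iN fl inv; last first.
  have [k [c' [k15 inv' run]]] := run_ram_iteration hW ok iN inv.
  have kf : k <= fuel by lia.
  by rewrite -(subnKC kf) run; apply: IH inv'; lia.
case: c inv => p R M; rewrite /loop_inv drop0.
have ok0 : all (fun x => 0 < x) vals by apply: sub_all ok => x /andP[].
have := back_greedy_inv n h ok0.
case: (back_greedy n h vals) => m D [/= mn Dh _ _].
case=> -> [R0 R1 R2 R3] [R4 R5 _ _] _ _.
have r1 : (size D + m) %% W = size D + m by rewrite modn_small //; lia.
have f4 : 4 <= fuel by lia.
rewrite -(subnKC f4) addnC.
do 3 (ram_step (R0, R1, R2, R3, R4, R5, r1)).
by rewrite addnS.
Qed.

Lemma run_back_prog n h vals W fuel :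
  size vals + n + h + 4 <= W -> all (fun x => 0 < x <= n) vals ->
  15 * size vals + 10 <= fuel ->
  run_ram W back_prog fuel (init_config n h vals) =
    Some (1 - (size (back_greedy n h vals).2 + (back_greedy n h vals).1)).
Proof.
move=> hW ok fl; have f6 : 6 <= fuel by lia.
have w1 : 1 %% W = 1 by rewrite modn_small //; lia.
have w2 : 2 %% W = 2 by rewrite modn_small //; lia.
have w3 : (size vals + 2) %% W = size vals + 2 by rewrite modn_small //; lia.
rewrite -(subnKC f6) addnC /init_config.
do 6 (ram_step (w1, w2, w3)).
rewrite addn0; apply: (run_ram_loop hW ok (leqnn _)); first by lia.
rewrite /loop_inv drop_size /=; split=> //.
- by split=> //; rewrite addn2.
- by move=> j _; rewrite !subSS subn0.
(* For [v > 0] the flag lies beyond the input, where memory is 0; this is right since initially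
   [m = n]. *)
move=> v /andP[v0 vn]; rewrite addSn addSn !subSS.
by rewrite ifF ?nth_default ?ltnNge ?vn //; lia.
Qed.

Theorem theorem1 :
  exists (P : seq instr) (C : nat),
    forall (n h : nat) (deck : seq hcard),
      all (fun x : hcard => (1 <= x.1 <= n) && (x.2 == 1)) deck ->
      exists out : nat,
        run_ram (word_bound n h (size deck)) P
          (C * (size deck + n * trunc_log 2 h + 1)).+1
          (init_config n h (map fst deck)) = Some out
        /\ (out = 1 <-> winnable n 1 h deck).
Proof.
(* 15 bounds one iteration; the additive term covers the 6 instructions before the loop and the 4 of
   its exit. *)
exists back_prog, 15 => n h deck ok; eexists; split.
  apply: run_back_prog; rewrite ?size_map ?all_map.
  - by rewrite /word_bound -{1}[_ + 4]expn1 leq_exp2l //; lia.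
  - by apply: sub_all ok => x /andP[].
  - by rewrite !mulnDr -addnA -addnS leq_add2l; lia.
rewrite (winnableP h ok); case: back_greedy => m D /=.
split=> [e|[-> ->] //].
have m0 : m = 0 by lia.
have D0 : size D = 0 by lia.
by rewrite m0 (size0nil D0).
Qed.
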